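(* Let $q$ be a prime power, $m,n,k,\rho$ positive integers, let $\mathcal{C}$ be a nondegenerate $[n,k]_{q^m/q}$ rank-metric code and let $\mathcal{U}$ be an $[n,k]_{q^m/q}$ system associated with $\mathcal{C}$. Then $\mathcal{U}$ is rank-$\rho$-saturating if and only if $\rho_{\mathrm{rk}}(\mathcal{C}^\perp)=\rho$.
   Context: An $[n,k]_{q^m/q}$ code is a $k$-dimensional $\mathbb{F}_{q^m}$-subspace of $\mathbb{F}_{q^m}^{1\times n}$; a generator matrix is a $k\times n$ matrix over $\mathbb{F}_{q^m}$ whose rows form a basis. It is nondegenerate if the $\mathbb{F}_q$-span of the columns of a generator matrix has $\mathbb{F}_q$-dimension $n$. A system associated with $\mathcal{C}$ is the $\mathbb{F}_q$-span of the columns of a generator matrix of $\mathcal{C}$. The dual is $\mathcal{C}^\perp=\{v\in\mathbb{F}_{q^m}^{1\times n}: \sum_j v_jc_j=0\ \forall c\in\mathcal{C}\}$. Rank weight: $\mathrm{wt}_{\mathrm{rk}}(x)=\dim_{\mathbb{F}_q}\langle x_1,\ldots,x_n\rangle_{\mathbb{F}_q}$; rank distance $d_{\mathrm{rk}}(x,y)=\mathrm{wt}_{\mathrm{rk}}(x-y)$. The rank covering radius of a code $\mathcal{D}\le\mathbb{F}_{q^m}^{1\times n}$ is $\rho_{\mathrm{rk}}(\mathcal{D})=\max_{x\in\mathbb{F}_{q^m}^{1\times n}}\min_{c\in\mathcal{D}} d_{\mathrm{rk}}(x,c)$. An $[n,k]_{q^m/q}$ system is an $n$-dimensional $\mathbb{F}_q$-subspace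 $\mathcal{U}\le\mathbb{F}_{q^m}^k$ with $\langle\mathcal{U}\rangle_{\mathbb{F}_{q^m}}=\mathbb{F}_{q^m}^k$; its linear set is $L_\mathcal{U}=\{\langle u\rangle_{\mathbb{F}_{q^m}}: u\in\mathcal{U}\setminus\{0\}\}\subseteq\mathrm{PG}(k-1,q^m)$. A set $\mathcal{S}$ of points of $\mathrm{PG}(k-1,q^m)$ is $r$-saturating if every point lies in the projective subspace spanned by some $r+1$ points of $\mathcal{S}$ and $r$ is the smallest such integer. $\mathcal{U}$ is rank-$\rho$-saturating if $L_\mathcal{U}$ is $(\rho-1)$-saturating. *)

(* Defs.v *)
From HB Require Import structures.
From mathcomp Require Export all_boot all_order all_fingroup all_algebra all_solvable all_field.

Set Implicit Arguments.
Unset Strict Implicit.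
Unset Printing Implicit Defensive.

Export GRing.Theory.
Local Open Scope ring_scope.

(* F plays the role of F_q and L that of F_{q^m}. The field L is finite, but as *)
(* a fieldExtType it carries no canonical finType structure; [finvect_type L]   *)
(* is convertible to L and does, so it is used for finite ranges of L-vectors.  *)
(* 'rV[L]_n and 'cV[L]_k are vector spaces over L only. The space L^k seen over *)
(* F is {ffun 'I_k -> L}, and [colv] identifies it with 'cV[L]_k.               *)

Section RankMetric.
Variables (F : finFieldType) (L : fieldExtType F).

Definition colv (k : nat) (u : {ffun 'I_k -> L}) : 'cV[L]_k := \col_i u i.

Definition generator_mx (n k : nat) (C : {vspace 'rV[L]_n}) (G : 'M[L]_(k, n)) :=
  basis_of C [seq row i G | i <- enum 'I_k].

Definition col_span (n k : nat) (G : 'M[L]_(k, n)) : {vspace {ffun 'I_k -> L}} :=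
  <<[seq [ffun i => G i j] | j <- enum 'I_n]>>%VS.

Definition nondegenerate (n : nat) (C : {vspace 'rV[L]_n}) : Prop :=
  exists2 G : 'M[L]_(\dim C, n), generator_mx C G & \dim (col_span G) = n.

Definition associated_system (n k : nat) (C : {vspace 'rV[L]_n})
    (U : {vspace {ffun 'I_k -> L}}) : Prop :=
  exists2 G : 'M[L]_(k, n), generator_mx C G & U = col_span G.

(* The second condition says that the L-span of U, i.e. the least L-subspace    *)
(* containing U, is the whole space.                                            *)
Definition is_system (n k : nat) (U : {vspace {ffun 'I_k -> L}}) : Prop :=
  \dim U = n /\
  forall W : {vspace 'cV[L]_k}, {in U, forall u, colv u \in W} -> W = fullv.

Definition dual_code (n : nat) (C : {vspace 'rV[L]_n}) : {vspace 'rV[L]_n} :=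
  (\bigcap_(c : 'rV[finvect_type L]_n | (c : 'rV[L]_n) \in C)
     lker (linfun (fun v : 'rV[L]_n => (\sum_j v 0 j * c 0 j : L^o)%R)))%VS.

Lemma mem_dual_code (n : nat) (C : {vspace 'rV[L]_n}) (v : 'rV[L]_n) :
  v \in dual_code C <->
  forall c : 'rV[L]_n, c \in C -> \sum_j v 0 j * c 0 j = 0.
Proof.
have dotE (c : 'rV[L]_n) :
    (v \in lker (linfun (fun w : 'rV[L]_n => (\sum_j w 0 j * c 0 j : L^o))))
    = (\sum_j v 0 j * c 0 j == 0).
  pose f (w : 'rV[L]_n) : L^o := \sum_j w 0 j * c 0 j.
  have lin_f : linear f.
    move=> a x y; rewrite /f scaler_sumr -big_split /=; apply: eq_bigr => j _.
    by rewrite !mxE mulrDl -mulrA.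
  pose fM := GRing.isLinear.Build _ _ _ _ f lin_f.
  pose fL : {linear 'rV[L]_n -> L^o} := HB.pack f fM.
  by rewrite memv_ker -[LHS]/(linfun fL v == 0) lfunE.
rewrite memvE /dual_code; split=> [/subv_bigcapP vC c cC|vC].
  by apply/eqP; rewrite -dotE memvE; apply: vC.
by apply/subv_bigcapP => c cC; rewrite -memvE dotE vC.
Qed.

Definition rk_weight (n : nat) (x : 'rV[L]_n) : nat :=
  \dim <<[seq (x 0 j)%R | j <- enum 'I_n]>>%VS.

Definition rk_dist (n : nat) (x y : 'rV[L]_n) : nat := rk_weight (x - y).

Definition rk_dist_code (n : nat) (D : {vspace 'rV[L]_n}) (x : 'rV[L]_n) : nat :=
  rk_dist x [arg min_(c < (0 : 'rV[finvect_type L]_n) | (c : 'rV[L]_n) \in D)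
               rk_dist x c].

Definition rk_covering_radius (n : nat) (D : {vspace 'rV[L]_n}) : nat :=
  (\max_(x : 'rV[finvect_type L]_n) rk_dist_code D x)%N.

(* A point of PG(k - 1, q^m) is a subspace P of 'cV[L]_k with \dim P = 1.       *)
Definition linear_set (k : nat) (U : {vspace {ffun 'I_k -> L}})
    (P : {vspace 'cV[L]_k}) : Prop :=
  exists u, [/\ u \in U, u != 0 & P = <[colv u]>%VS].

Definition points_covered (k r : nat) (S : {vspace 'cV[L]_k} -> Prop) : Prop :=
  forall P : {vspace 'cV[L]_k}, \dim P = 1%N ->
    exists s : seq {vspace 'cV[L]_k},
      [/\ uniq s, size s = r.+1, {in s, forall Q, S Q}
        & (P <= \sum_(Q <- s) Q)%VS].

Definition saturating (k r : nat) (S : {vspace 'cV[L]_k} -> Prop) : Prop :=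
  points_covered r S /\ forall r', points_covered r' S -> (r <= r')%N.

(* Meaningful for rho > 0 only. *)
Definition rank_saturating (k rho : nat) (U : {vspace {ffun 'I_k -> L}}) : Prop :=
  saturating rho.-1 (linear_set U).

End RankMetric.

(* Main.v *)
From HB Require Import structures.
Require Import Defs.

Set Implicit Arguments.
Unset Strict Implicit.
Unset Printing Implicit Defensive.

(* A vector y has rank weight at most r iff y = a B with a in L^r and an      *)
(* r-row matrix B over F. Its syndrome G y^T = (G B^T) a^T is then an         *)
(* L-combination of r vectors in the F-span U of the columns of G, and every  *)
(* L-combination of r vectors of U arises in this way. When G is a            *)
(* parity-check matrix of D, the cosets of D correspond to the syndromes,     *)
(* which fill L^k, so the covering radius of D is the least r such that every *)
(* vector of L^k is an L-combination of r vectors of U. In terms of points, a *)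
(* free family of at most r vectors of U extends to a basis of L^k inside U,  *)
(* and so, for r <= k, to r vectors that generate distinct points of the      *)
(* linear set.                                                                *)

Local Open Scope ring_scope.

Section VectorSpaces.
Variables (K : fieldType) (vT : vectType K).

Lemma span_familyP (I : finType) (f : I -> vT) w :
  reflect (exists a : I -> K, w = \sum_i a i *: f i)
          (w \in <<[seq f i | i <- enum I]>>%VS).
Proof.
rewrite span_def big_map big_enum.
apply: (iffP memv_sumP) => [[v vf ->]|[a ->]].
  have [a va] : exists a : I -> K, forall i, v i = a i *: f i.
    apply: (fin_all_exists (P := fun i c => v i = c *: f i)) => i.
    exact/vlineP/vf.
  by exists a; apply: eq_bigr => i _.
by exists (fun i => a i *: f i) => // i _; rewrite memvZ ?memv_line.
Qed.

Lemma exists_free_extension (T : eqType) (f : T -> vT) (s t : seq T) :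
    free [seq f x | x <- s] ->
  exists t', [/\ subseq t' t, free [seq f x | x <- s ++ t']
    & <<[seq f x | x <- s ++ t']>>%VS = <<[seq f x | x <- s ++ t]>>%VS].
Proof.
elim: t s => [|x t IHt] s free_s; first by exists [::]; rewrite cats0.
have [fx_s|fx_s] := boolP (f x \in <<[seq f y | y <- s]>>%VS).
  have [t' [t't free_t' span_t']] := IHt s free_s; exists t'; split=> //.
    exact: subseq_trans t't (subseq_cons _ _).
  rewrite span_t' !map_cat !span_cat /= span_cons addvA; congr (_ + _)%VS.
  by apply/esym/addv_idPl; rewrite -memvE.
have [|t' [t't]] := IHt (rcons s x).
  rewrite map_rcons -cats1 (perm_free (permEl (perm_catC _ _))).
  by rewrite free_cons fx_s.
by rewrite !cat_rcons; exists (x :: t'); split; rewrite //= eqxx.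
Qed.

Lemma free_uniq_vlines (X : seq vT) : free X -> uniq [seq <[v]>%VS | v <- X].
Proof.
elim: X => //= v X IHX; rewrite free_cons => /andP[vX freeX].
rewrite IHX // andbT.
apply: contra vX => /mapP[w wX vw].
by rewrite memvE vw -memvE memv_span.
Qed.

Lemma sum_vlines (T : Type) (f : T -> vT) (s : seq T) :
  (\sum_(P <- [seq <[f x]> | x <- s]) P = <<[seq f x | x <- s]>>)%VS.
Proof. by rewrite span_def !big_map. Qed.

Lemma dim1_vline (P : {vspace vT}) : \dim P = 1%N -> P = <[vpick P]>%VS.
Proof.
move=> dimP; apply/esym/eqP.
by rewrite eqEdim -memvE memv_pick dimP dim_vline vpick0 -dimv_eq0 dimP.
Qed.

End VectorSpaces.

Section MatrixSpans.
Variable K : fieldType.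

Lemma span_rowsP m n (A : 'M[K]_(m, n)) w :
  reflect (exists a : 'rV_m, w = a *m A)
          (w \in <<[seq row i A | i <- enum 'I_m]>>%VS).
Proof.
apply: (iffP (span_familyP _ _)) => [[a ->]|[a ->]].
  exists (\row_i a i); rewrite mulmx_sum_row.
  by apply: eq_bigr => i _; rewrite mxE.
by exists (a 0); rewrite mulmx_sum_row.
Qed.

Lemma span_colsP m n (A : 'M[K]_(m, n)) w :
  reflect (exists a : 'cV_n, w = A *m a)
          (w \in <<[seq col j A | j <- enum 'I_n]>>%VS).
Proof.
have mulmx_sum_col (a : 'cV_n) : A *m a = \sum_j a j 0 *: col j A.
  apply/colP=> i; rewrite summxE mxE.
  by apply: eq_bigr => j _; rewrite !mxE mulrC.
apply: (iffP (span_familyP _ _)) => [[a ->]|[a ->]].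
  exists (\col_j a j); rewrite mulmx_sum_col.
  by apply: eq_bigr => j _; rewrite mxE.
by exists (a^~ 0); rewrite mulmx_sum_col.
Qed.

Lemma free_row_free m n (A : 'M[K]_(m, n)) :
  free [seq row i A | i <- enum 'I_m] -> row_free A.
Proof.
move=> free_A; apply: inj_row_free => w; rewrite mulmx_sum_row => wA0.
have /freeP coef0 : free [tuple row i A | i < m] by [].
apply/rowP=> i; rewrite mxE; apply: (coef0 (fun i => w 0 i)).
by rewrite -[RHS]wA0; apply: eq_bigr => l _; rewrite -tnth_nth tnth_mktuple.
Qed.

End MatrixSpans.

Section Syndromes.
Variables (F : finFieldType) (L : fieldExtType F).
Local Notation extmx := (map_mx (in_alg L)).

Lemma rk_weight_factor n (y : 'rV[L]_n) :
  exists (a : 'rV[L]_(rk_weight y)) (B : 'M[F]_(rk_weight y, n)),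
    y = a *m extmx B.
Proof.
pose Y := <<[seq (y 0 j)%R | j <- enum 'I_n]>>%VS; pose b := vbasis Y.
exists (\row_l b`_l), (\matrix_(l, j) coord b l (y 0 j)); apply/rowP=> j.
have yY : y 0 j \in Y by rewrite memv_span // map_f // mem_enum.
rewrite mxE {1}(coord_basis (vbasisP Y) yY); apply: eq_bigr => l _.
by rewrite !mxE mulr_algr.
Qed.

Lemma rk_weight_mulmx_leq r n (a : 'rV[L]_r) (B : 'M[F]_(r, n)) :
  (rk_weight (a *m extmx B) <= r)%N.
Proof.
rewrite -[leqRHS]size_enum_ord -(size_map (fun l => a 0 l)).
apply: leq_trans (dim_span _); apply/dimvS/span_subvP => _ /mapP[j _ ->].
apply/span_familyP; exists (fun l => B l j); rewrite mxE.
by apply: eq_bigr => l _; rewrite !mxE mulr_algr.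
Qed.

Fact colv_is_semilinear k :
  GRing.semilinear_for (in_alg L \; *:%R) (@colv F L k).
Proof. by split=> [a u|u v]; apply/colP=> i; rewrite !mxE ffunE ?mulr_algl. Qed.

HB.instance Definition _ k :=
  GRing.isSemilinear.Build F {ffun 'I_k -> L} 'cV[L]_k (in_alg L \; *:%R)
    (@colv F L k) (@colv_is_semilinear k).

Lemma colv_inj k : injective (@colv F L k).
Proof. by move=> u v /colP uv; apply/ffunP=> i; have := uv i; rewrite !mxE. Qed.

Lemma colv_finfun k n (A : 'M[L]_(k, n)) j :
  @colv F L k [ffun i => A i j] = col j A.
Proof. by apply/colP=> i; rewrite !mxE ffunE. Qed.

Lemma mem_col_spanP n k (G : 'M[L]_(k, n)) (u : {ffun 'I_k -> L}) :
  reflect (exists b : 'cV[F]_n, colv u = G *m extmx b) (u \in col_span G).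
Proof.
have mulGE (b : 'cV[F]_n) :
    G *m extmx b = colv (\sum_j b j 0 *: [ffun i => G i j]).
  apply/colP=> i; rewrite !mxE sum_ffunE.
  by apply: eq_bigr => j _; rewrite !(mxE, ffunE) mulr_algr.
apply: (iffP (span_familyP _ _)) => [[b ->]|[b]].
  exists (\col_j b j); rewrite mulGE; congr colv.
  by apply: eq_bigr => j _; rewrite mxE.
by rewrite mulGE => /colv_inj ->; exists (b^~ 0).
Qed.

Definition spanned_by_at_most (k r : nat) (U : {vspace {ffun 'I_k -> L}})
    (v : 'cV[L]_k) : Prop :=
  exists t : seq {ffun 'I_k -> L},
    [/\ (size t <= r)%N, {subset t <= U} & v \in <<[seq colv u | u <- t]>>%VS].

Definition rank_covering (k r : nat) (U : {vspace {ffun 'I_k -> L}}) : Prop :=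
  forall v, spanned_by_at_most r U v.

Lemma syndrome_spanned n k (G : 'M[L]_(k, n)) (y : 'rV[L]_n) :
  spanned_by_at_most (rk_weight y) (col_span G) (G *m y^T).
Proof.
have [a [B defy]] := rk_weight_factor y; pose GB := G *m extmx B^T.
exists [seq [ffun i => GB i l] | l <- enum 'I_(rk_weight y)]; split.
- by rewrite size_map size_enum_ord.
- move=> _ /mapP[l _ ->]; apply/mem_col_spanP; exists (col l B^T).
  by rewrite colv_finfun map_col !colE mulmxA.
rewrite -map_comp (eq_map (colv_finfun GB)); apply/span_colsP; exists a^T.
by rewrite {1}defy trmx_mul mulmxA map_trmx.
Qed.

Lemma spanned_syndrome n k r (G : 'M[L]_(k, n)) (v : 'cV[L]_k) :
    spanned_by_at_most r (col_span G) v ->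
  exists2 y : 'rV[L]_n, G *m y^T = v & (rk_weight y <= r)%N.
Proof.
case=> t [tr tU].
have {1}<- : [seq tnth (in_tuple t) l | l <- enum 'I_(size t)] = t.
  exact: map_tnth_enum (in_tuple t).
rewrite -map_comp => /span_familyP[a ->].
have [b Gb] : exists b : 'I_(size t) -> 'cV[F]_n,
    forall l, colv (tnth (in_tuple t) l) = G *m extmx (b l).
  pose P l b := colv (tnth (in_tuple t) l) = G *m extmx b.
  by apply: (fin_all_exists (P := P)) => l; apply/mem_col_spanP/tU/mem_tnth.
exists (\row_l a l *m extmx (\matrix_l (b l)^T)).
  rewrite mulmx_sum_row linear_sum mulmx_sumr; apply: eq_bigr => l _ /=.
  by rewrite Gb mxE linearZ /= -map_row rowK map_trmx trmxK -scalemxAr.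
exact: leq_trans (rk_weight_mulmx_leq _ _) tr.
Qed.

Definition parity_check_mx (n k : nat) (D : {vspace 'rV[L]_n})
    (H : 'M[L]_(k, n)) : Prop :=
  row_free H /\ forall v, v \in D <-> H *m v^T = 0.

Lemma generator_parity_check_dual n k (C : {vspace 'rV[L]_n})
    (G : 'M[L]_(k, n)) :
  generator_mx C G -> parity_check_mx (dual_code C) G.
Proof.
move=> /andP[/eqP defC freeG]; split=> [|v]; first exact: free_row_free.
have dotE (w : 'rV[L]_n) : \sum_j v 0 j * w 0 j = (w *m v^T) 0 0.
  by rewrite mxE; apply: eq_bigr => j _; rewrite mxE mulrC.
split=> [/mem_dual_code vC|Gv]; last first.
  apply/mem_dual_code => c; rewrite -defC => /span_rowsP[a ->].
  by rewrite dotE -mulmxA Gv mulmx0 mxE.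
apply/row_matrixP=> i; rewrite row_mul row0; apply/rowP=> j.
rewrite ord1 [RHS]mxE -dotE; apply: vC; rewrite -defC memv_span //.
by rewrite (map_f (fun i => row i G)) // mem_enum.
Qed.

Lemma rk_dist_code_leP n (D : {vspace 'rV[L]_n}) (x : 'rV[L]_n) r :
  (rk_dist_code D x <= r)%N <-> exists2 c, c \in D & (rk_dist x c <= r)%N.
Proof.
rewrite /rk_dist_code; case: arg_minnP => [|c cD cmin]; first exact: mem0v.
split=> [cr|[c' c'D c'r]]; first by exists c.
exact: leq_trans (cmin c' c'D) c'r.
Qed.

Lemma rk_covering_radius_leP n (D : {vspace 'rV[L]_n}) r :
  (rk_covering_radius D <= r)%N <->
  forall x : 'rV[L]_n, exists2 c, c \in D & (rk_dist x c <= r)%N.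
Proof.
split=> [/bigmax_leqP Dr x|Dr]; first exact/rk_dist_code_leP/(Dr x).
by apply/bigmax_leqP => x _; apply/rk_dist_code_leP/Dr.
Qed.

Lemma parity_check_covering_radius_leP n k (D : {vspace 'rV[L]_n})
    (H : 'M[L]_(k, n)) r :
  parity_check_mx D H ->
  (rk_covering_radius D <= r)%N <-> rank_covering r (col_span H).
Proof.
case=> /row_freeP[B HB] DH; split=> [/rk_covering_radius_leP Dr v|Hr].
  have [c /DH Hc cr] := Dr (B *m v)^T.
  have [t [tw tU]] := syndrome_spanned H ((B *m v)^T - c).
  rewrite linearB /= trmxK mulmxBr mulmxA HB mul1mx Hc subr0 => vt.
  by exists t; split=> //; apply: leq_trans tw cr.
apply/rk_covering_radius_leP => x.
have [y Hy yr] := spanned_syndrome (Hr (H *m x^T)).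
exists (x - y); last by rewrite /rk_dist subKr.
by apply/DH; rewrite linearB /= mulmxBr Hy subrr.
Qed.

End Syndromes.

Section SaturatingSystems.
Variables (F : finFieldType) (L : fieldExtType F) (n k : nat).
Variable U : {vspace {ffun 'I_k -> L}}.

Lemma system_span :
  is_system n U -> <<[seq colv u | u <- vbasis U]>>%VS = fullv.
Proof.
case=> _; apply=> u /(coord_basis (vbasisP U)) ->.
rewrite linear_sum; apply: memv_suml => i _.
by rewrite linearZ memvZ // memv_span // map_f // mem_nth // size_tuple.
Qed.

Lemma system_basis_extension (s : seq {ffun 'I_k -> L}) :
    is_system n U -> {subset s <= U} -> free [seq colv u | u <- s] ->
  exists t, [/\ {subset s ++ t <= U}, size (s ++ t) = k
    & basis_of fullv [seq colv u | u <- s ++ t]].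
Proof.
move=> sysU sU /(exists_free_extension (vbasis U))[t [tb free_st span_st]].
have basis_st : basis_of fullv [seq colv u | u <- s ++ t].
  rewrite /basis_of free_st span_st map_cat span_cat (system_span sysU) andbT.
  exact/eqP/addv_idPr/subvf.
exists t; split=> // [u|].
  by rewrite mem_cat => /orP[/sU//|/(mem_subseq tb)/vbasis_mem].
rewrite -(size_map (@colv F L k)) -(size_basis (X := in_tuple _) basis_st).
by rewrite dimvf /dim /= muln1.
Qed.

Lemma system_rank_covering : is_system n U -> rank_covering k U.
Proof.
move=> sysU v; have [//||t /= [tU size_t /span_basis span_t]] :=
  system_basis_extension (s := [::]) sysU; first exact: nil_free.
by exists t; rewrite size_t span_t memvf.
Qed.

Lemma linear_set_points (s : seq {vspace 'cV[L]_k}) :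
    {in s, forall P, linear_set U P} ->
  exists2 t : seq {ffun 'I_k -> L},
    {subset t <= U} & s = [seq <[colv u]>%VS | u <- t].
Proof.
elim: s => [|P s IHs] sU; first by exists [::].
have [|t tU ->] := IHs; first by move=> Q Qs; apply: sU; rewrite inE Qs orbT.
have [u [uU _ ->]] := sU P (mem_head _ _).
by exists (u :: t) => // x; rewrite inE => /predU1P[->|/tU].
Qed.

Lemma spanned_by_free_family r v : is_system n U -> (r <= k)%N ->
    spanned_by_at_most r U v ->
  exists t : seq {ffun 'I_k -> L}, [/\ size t = r, {subset t <= U},
    free [seq colv u | u <- t] & v \in <<[seq colv u | u <- t]>>%VS].
Proof.
move=> sysU rk [t [tr tU vt]].
have [|s [st free_s span_s]] :=
  exists_free_extension (f := @colv F L k) (s := [::]) t; first exact: nil_free.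
have sU : {subset s <= U} by move=> u /(mem_subseq st)/tU.
have [e [seU size_se /basis_free]] := system_basis_extension sysU sU free_s.
rewrite -{1}(cat_take_drop r (s ++ e)) map_cat => /catl_free free_w.
exists (take r (s ++ e)); split=> //; first by rewrite size_takel ?size_se.
  by move=> u /mem_take/seU.
have sr : (size s <= r)%N := leq_trans (size_subseq st) tr.
rewrite -span_s in vt; apply: subvP vt; apply/sub_span => _ /mapP[u us ->].
by rewrite map_f // take_cat ltnNge sr mem_cat us.
Qed.

Lemma points_covered_rank_covering r :
  points_covered r (linear_set U) -> rank_covering r.+1 U.
Proof.
move=> cov v; have [->|v0] := eqVneq v 0; first by exists [::]; rewrite mem0v.
have [|s [_ size_s /linear_set_points[t tU defs]]] := cov <[v]>%VS.
  by rewrite dim_vline v0.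
rewrite defs sum_vlines -memvE => vt.
by exists t; rewrite -size_s defs size_map.
Qed.

Lemma rank_covering_points_covered r : is_system n U -> (r < k)%N ->
  rank_covering r.+1 U -> points_covered r (linear_set U).
Proof.
move=> sysU rk Ur P /dim1_vline ->.
have [t [size_t tU free_t vt]] := spanned_by_free_family sysU rk (Ur (vpick P)).
exists [seq <[colv u]>%VS | u <- t]; rewrite sum_vlines -memvE size_map.
split=> // [|_ /mapP[u ut ->]].
  by rewrite (map_comp (fun v => <[v]>%VS)) free_uniq_vlines.
exists u; split=> //; first exact: tU.
have := free_not0 free_t (map_f _ ut).
by apply: contraNneq => ->; rewrite linear0.
Qed.

Lemma rank_covering_gt0 r : (0 < k)%N -> rank_covering r U -> (0 < r)%N.
Proof.
move=> k_gt0 Ur; rewrite lt0n; apply/eqP => r0.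
have [t []] := Ur (const_mx 1); rewrite r0 leqn0 => /nilP -> _ /=.
rewrite span_nil memv0 => /eqP/matrixP/(_ (Ordinal k_gt0) 0)/eqP.
by rewrite !mxE oner_eq0.
Qed.

Lemma rank_saturatingP rho : is_system n U -> (0 < k)%N -> (0 < rho)%N ->
  rank_saturating rho U <->
  rank_covering rho U /\ forall r, rank_covering r U -> (rho <= r)%N.
Proof.
case: rho => // rho sysU k_gt0 _; split=> [[cov cov_min]|[Urho Umin]].
  have le_rho r : (r <= k)%N -> rank_covering r U -> (rho < r)%N.
    move=> rk Ur; case: r rk Ur (rank_covering_gt0 k_gt0 Ur) => // r rk Ur _.
    exact/cov_min/rank_covering_points_covered.
  split=> [|r Ur]; first exact: points_covered_rank_covering.
  have [rk|kr] := leqP r k; first exact: le_rho.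
  apply: leq_trans (ltnW kr); apply: le_rho => //.
  exact: system_rank_covering.
split=> [|r /points_covered_rank_covering/Umin //].
apply: rank_covering_points_covered => //.
by apply: Umin; apply: system_rank_covering.
Qed.

End SaturatingSystems.

Local Close Scope ring_scope.

Theorem theorem2p5 (q m n k rho : nat) (F : finFieldType) (L : fieldExtType F)
  (hF : #|F| = q) (hL : \dim (fullv : {vspace L}) = m)
  (hm : 0 < m) (hn : 0 < n) (hk : 0 < k) (hrho : 0 < rho)
  (C : {vspace 'rV[L]_n}) (hC : \dim C = k) (hCnd : nondegenerate C)
  (U : {vspace {ffun 'I_k -> L}}) (hU : is_system n U)
  (hCU : associated_system C U) :
  rank_saturating rho U <-> rk_covering_radius (dual_code C) = rho.
Proof.
case: hCU => G /generator_parity_check_dual pcG defU.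
have radius_leP r := parity_check_covering_radius_leP r pcG.
rewrite -defU in radius_leP; apply: iff_trans (rank_saturatingP hU hk hrho) _.
split=> [[/radius_leP le_rho min_rho]|<-].
  by apply/eqP; rewrite eqn_leq le_rho; apply/min_rho/radius_leP.
by split=> [|r /radius_leP //]; apply/radius_leP.
Qed.
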